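(* Let $\mathcal C$ be a 2D convolutional code with generator matrix $G(z_1,z_2)\in\mathbb F[z_1,z_2]^{n\times k}$, and let $\hat v(z_1,z_2)$ be the received word (with erasures) corresponding to a sent codeword $v=Gu$. Suppose there are $\alpha,\beta\in\{1,2\}$ with $\alpha\ne\beta$ and $\mu_\alpha=e_\beta$, where $G=\sum_{l=0}^{\mu_\alpha}G^{(\beta)}_l(z_\beta)z_\alpha^l$, $k<n$, $G_0^{(\beta)}(z_\beta)$ has full column rank and $e_\beta$ is the largest integer $e\ge0$ such that $k(e+1)<n$ and $[G^{(\beta)}_e(z_\beta),\dots,G_0^{(\beta)}(z_\beta)]$ has full column rank. Suppose moreover that there are indices $0\le j_0<j_1<\cdots<j_l=\mu_\alpha+m_\alpha$ with $j_0\le\mu_\alpha$ and $j_r-(j_{r-1}+1)\le\mu_\alpha$ for $r=1,\dots,l$, such that the erasure pattern of $\hat v^{(\beta)}_{j_0}(z_\beta)$ can be decoded in the code generated by $[G^{(\beta)}_{j_0}(z_\beta),\dots,G^{(\beta)}_0(z_\beta)]$ and, for $r=1,\dots,l$, the erasure pattern of $\hat v^{(\beta)}_{j_r}(z_\beta)$ can be decoded in the code generated by $[G^{(\beta)}_{j_r-(j_{r-1}+1)}(z_\beta),\dots,G^{(\beta)}_0(z_\beta)]$. Then Algorithm 2.2 (run with these $\alpha,\beta$) leads to complete recovery of all erasures.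
   Context: $\mathbb F$ is a finite field. A 2D $(n,k)$ convolutional code is a free $\mathbb F[z_1,z_2]$-submodule $\mathcal C=\{G(z_1,z_2)u : u\in\mathbb F[z_1,z_2]^k\}$ of $\mathbb F[z_1,z_2]^n$ of rank $k$. $\mu_\alpha=\deg_{z_\alpha}G$, $m_\alpha$ is the degree of the message $u=\sum_{i=0}^{m_\alpha}u_i^{(\beta)}(z_\beta)z_\alpha^i$ in $z_\alpha$, $d_\alpha=\mu_\alpha+m_\alpha$ (and similarly $d_\beta$). With $u_i^{(\beta)}=0$ for $i>m_\alpha$ and $G^{(\beta)}_l=0$ for $l>\mu_\alpha$, the codeword is $v=\sum_{i=0}^{d_\alpha}v_i^{(\beta)}(z_\beta)z_\alpha^i$ with $v_i^{(\beta)}(z_\beta)=\sum_{l+m=i}G_l^{(\beta)}(z_\beta)u_m^{(\beta)}(z_\beta)$. The received word is $\hat v=\sum_{i\le d_\alpha}\hat v_i^{(\beta)}(z_\beta)z_\alpha^i$; each component of each coefficient vector of $v_i^{(\beta)}(z_\beta)$ either arrives correctly or is erased, with known erasure positions. The receiver knows $d_\alpha,d_\beta$ but not $m_\alpha$ separately. 1D codes. For a full column rank $M(z)\in\mathbb F[z]^{n\times\kappa}$, $\kappa<n$, let $\mathcal D=\{M(z)w:w\in\mathbb F[z]^\kappa\}$ and let $\tilde{\mathcal D}$ be the smallest noncatastrophic code containing $\mathcal D$, i.e. $\tilde{\mathcal D}=\operatorname{Im}\tilde M(z)$ where $M=\tilde MX$ with $\tilde M\in\mathbb F[z]^{n\times\kappa}$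 right prime (meaning $\tilde M=\bar MY$ with $\bar M\in\mathbb F[z]^{n\times\kappa}$, $Y\in\mathbb F[z]^{\kappa\times\kappa}$ forces $Y$ unimodular) and $X\in\mathbb F[z]^{\kappa\times\kappa}$ nonsingular; $\tilde{\mathcal D}$ is the kernel of a left prime $H(z)\in\mathbb F[z]^{(n-\kappa)\times n}$. Column distances: $d_j^c(\tilde{\mathcal D})=\min\{\sum_{t=0}^j wt(w_t): \sum_t w_tz^t\in\tilde{\mathcal D},\ w_0\neq0\}$ with $wt$ the Hamming weight. Let $\hat w(z)=\sum_{i=0}^{s}\hat w_iz^i$ be a word of $\mathcal D$ with erasures, $\epsilon_i$ the number of erased components of $\hat w_i$ ($\epsilon_i=0$ for $i>s$). Its erasure pattern ''can be decoded (recovered) in the code generated by $M(z)$'' if for every $0\le i\le s$ there is $j\ge0$ with $\epsilon_i+\cdots+\epsilon_{i+j}\le d_j^c(\tilde{\mathcal D})-1$; in this case the erasures are recovered successively for $i=0,1,\dots,s$ by solving the linear equations coming from $H(z)w(z)=0$ (this procedure is ''Algorithm 1''). Algorithm 2.2 (case $\mu_\alpha=e_\beta$). Phase I (Steps 1-7): Start with $b=0$. At stage $b$, with $S=\sum_{t<b}x_t$ (so $u_0^{(\beta)},\dots,u_{S-1}^{(\beta)}$ are already known), try $x_b=e_\beta+1,e_\beta,\dots,1$ in this order (only values with $S+x_b-1\le d_\alpha$ are considered): if the erasure pattern of $\hat v^{(\beta)}_{S+x_b-1}(z_\beta)$ can be decoded in the code generated by $[G^{(\beta)}_{x_b-1}(z_\beta),\dots,G^{(\beta)}_0(z_\beta)]$,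 apply Algorithm 1 in this code to $\hat v^{(\beta)}_{S+x_b-1}-\sum_{l+m=S+x_b-1,\,m<S}G_l^{(\beta)}u_m^{(\beta)}$ to recover $v^{(\beta)}_{S+x_b-1}$, obtain $u_S^{(\beta)},\dots,u_{S+x_b-1}^{(\beta)}$ by injectivity of $[G^{(\beta)}_{x_b-1},\dots,G^{(\beta)}_0]$, and go to stage $b+1$. If no $x_b\ge1$ works, Phase I ends; if at that point $S\ge d_\alpha+1$, i.e. all $u_0^{(\beta)},\dots,u_{d_\alpha}^{(\beta)}$ are known, the algorithm stops with success (all erasures recovered). Phase II (Steps 8-18, executed only if Phase I ended without success): look for the smallest $y\ge1$ such that $\hat v^{(\beta)}_{\rho}$ with $\rho=S+\mu_\alpha+y$ can be decoded in the code generated by $[G^{(\beta)}_{\mu_\alpha},\dots,G^{(\beta)}_0]$, decode it to obtain $u^{(\beta)}_{\rho-\mu_\alpha},\dots,u^{(\beta)}_\rho$, then try to close the gap between the known $u^{(\beta)}_i$ by decoding, from larger to smaller indices, blocks $\hat v^{(\beta)}_i$ (after subtracting known contributions) in codes generated by $[G^{(\beta)}_{h},\dots,G^{(\beta)}_w]$ with $w\ge1$ minimal; if the gap is closed, subtract the known contributions, shift indices so that the first unrecovered block has index $0$, and restart with Phase I on the remaining blocks; otherwise end. *)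

(* Defs.v *)
From HB Require Import structures.
From mathcomp Require Import all_boot all_order all_algebra.

Set Implicit Arguments.
Unset Strict Implicit.
Unset Printing Implicit Defensive.

Import GRing.Theory.
Local Open Scope ring_scope.

Definition least (P : nat -> Prop) (x : nat) : Prop :=
  P x /\ forall y, P y -> (x <= y)%N.

Definition greatest (P : nat -> Prop) (x : nat) : Prop :=
  P x /\ forall y, P y -> (y <= x)%N.

Definition full_col_rank (R : idomainType) (m p : nat) (M : 'M[R]_(m, p)) : Prop :=
  \rank (map_mx (@tofrac R) M) = p.

Section OneDimensional.

Variables (F : finFieldType) (n : nat).

Definition code1 (p : nat) (M : 'M[{poly F}]_(n, p)) (w : 'cV[{poly F}]_n) : Prop :=
  exists x : 'cV[{poly F}]_p, w = M *m x.

(* Over {poly F}, unitmx is the set of unimodular matrices. *)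
Definition right_prime (p : nat) (M : 'M[{poly F}]_(n, p)) : Prop :=
  forall (Mb : 'M[{poly F}]_(n, p)) (Y : 'M[{poly F}]_p),
    M = Mb *m Y -> Y \in unitmx.

Definition left_prime (r : nat) (H : 'M[{poly F}]_(r, n)) : Prop :=
  forall (Y : 'M[{poly F}]_r) (Hb : 'M[{poly F}]_(r, n)),
    H = Y *m Hb -> Y \in unitmx.

(* Mt generates the smallest noncatastrophic code containing code1 M. *)
Definition noncatastrophic_closure (p : nat) (M Mt : 'M[{poly F}]_(n, p)) : Prop :=
  right_prime Mt /\ exists X : 'M[{poly F}]_p, \det X != 0 /\ M = Mt *m X.

Definition parity_check (p : nat) (Mt : 'M[{poly F}]_(n, p))
    (H : 'M[{poly F}]_(n - p, n)) : Prop :=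
  left_prime H /\ forall w : 'cV[{poly F}]_n, H *m w = 0 <-> code1 Mt w.

Definition wcoef (r : nat) (w : 'cV[{poly F}]_r) (t : nat) : 'cV[F]_r :=
  map_mx (coefp t) w.

Definition wt (x : 'cV[F]_n) : nat := #|[set c | x c 0 != 0]|.

(* d is the j-th column distance of code1 M. *)
Definition is_column_distance (p : nat) (M : 'M[{poly F}]_(n, p)) (j : nat) : nat -> Prop :=
  least (fun d => exists w, [/\ code1 M w, wcoef w 0 != 0
                              & d = \sum_(t < j.+1) wt (wcoef w t)]).

(* A received word: None is an erasure. Together with a degree bound s known to
   the receiver, only the entries with t <= s matter; the coefficients beyond s
   are known to be zero. *)
Definition rword := nat -> 'I_n -> option F.

Definition erasures (s : nat) (r : rword) (t : nat) : nat :=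
  if (t <= s)%N then #|[set c | r t c == None]| else 0%N.

Definition compatible (s : nat) (r : rword) (t : nat) (x : 'cV[F]_n) : Prop :=
  if (t <= s)%N then forall c a, r t c = Some a -> x c 0 = a else x = 0.

Definition window_ok (p : nat) (Mt : 'M[{poly F}]_(n, p)) (s : nat) (r : rword)
    (i j : nat) : Prop :=
  exists2 d, is_column_distance Mt j d &
    (\sum_(i <= t < (i + j).+1) erasures s r t < d)%N.

Definition decodable (p : nat) (M : 'M[{poly F}]_(n, p)) (s : nat) (r : rword) : Prop :=
  exists2 Mt, noncatastrophic_closure M Mt &
    forall i, (i <= s)%N -> exists j, window_ok Mt s r i j.

(* w' solves the equations given by the coefficients i, ..., i + j of H w' = 0,
   where the coefficients of w' before i are the ones already recovered in w and
   the unknowns are the erased components of the coefficients i, ..., i + j. *)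
Definition window_solution (q : nat) (H : 'M[{poly F}]_(q, n)) (s : nat) (r : rword)
    (w : 'cV[{poly F}]_n) (i j : nat) (w' : 'cV[{poly F}]_n) : Prop :=
  [/\ forall t, (t < i)%N -> wcoef w' t = wcoef w t,
      forall t, (i <= t <= i + j)%N -> compatible s r t (wcoef w' t)
    & forall t, (i <= t <= i + j)%N -> wcoef (H *m w') t = 0].

(* w is an output of the sliding window erasure decoder for the
   code generated by M: the coefficients w_0, ..., w_s are obtained successively,
   w_i being read off some solution of an admissible window starting at i. *)
Definition erasure_decoder_output (p : nat) (M : 'M[{poly F}]_(n, p)) (s : nat) (r : rword)
    (w : 'cV[{poly F}]_n) : Prop :=
  exists Mt : 'M[{poly F}]_(n, p), exists H : 'M[{poly F}]_(n - p, n),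
    [/\ noncatastrophic_closure M Mt, parity_check Mt H,
        forall i, (i <= s)%N -> exists j w',
          [/\ window_ok Mt s r i j, window_solution H s r w i j w'
            & wcoef w i = wcoef w' i]
      & forall i, (s < i)%N -> wcoef w i = 0].

End OneDimensional.

(* F[z_1, z_2] is {poly {poly F}}, with z_1 the outer and z_2 the inner
   variable: p`_a`_b is the coefficient of z_1^a z_2^b. The indices 1, 2 of the
   variables are the elements 0, 1 of 'I_2. *)
Section TwoDimensional.

Variables (F : finFieldType) (n k : nat).

(* p, with z_alpha as outer variable; this is an involution. *)
Definition outer (alpha : 'I_2) (p : {poly {poly F}}) : {poly {poly F}} :=
  if alpha == 0 then p else swapXY p.

(* The coefficient of z_alpha^l, a polynomial in the other variable. *)
Definition zcoef (alpha : 'I_2) (q r : nat) (M : 'M[{poly {poly F}}]_(q, r)) (l : nat) :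
    'M[{poly F}]_(q, r) :=
  map_mx (fun p => (outer alpha p)`_l) M.

Definition zdeg (alpha : 'I_2) (q r : nat) (M : 'M[{poly {poly F}}]_(q, r)) : nat :=
  \max_(i < q) \max_(j < r) (size (outer alpha (M i j))).-1.

(* A received word, indexed by the exponents of z_1 and z_2 and the component. *)
Definition rword2 := nat -> nat -> 'I_n -> option F.

Definition received (d1 d2 : nat) (v : 'cV[{poly {poly F}}]_n) (vhat : rword2) : Prop :=
  forall a b c, (a <= d1)%N -> (b <= d2)%N ->
    vhat a b c = None \/ vhat a b c = Some ((v c 0)`_a`_b).

Definition rblock (alpha : 'I_2) (vhat : rword2) (i : nat) : rword F n :=
  fun t c => if alpha == 0 then vhat i t c else vhat t i c.

(* The block row [G_h, ..., G_w] of coefficients with respect to z_alpha. *)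
Definition Gblock (alpha : 'I_2) (G : 'M[{poly {poly F}}]_(n, k)) (h w : nat) :
    'M[{poly F}]_(n, \sum_(i < (h - w).+1) k) :=
  \mxrow_(i < (h - w).+1) zcoef alpha G (h - i).

Definition e_candidate (alpha : 'I_2) (G : 'M[{poly {poly F}}]_(n, k)) (e : nat) : Prop :=
  (k * e.+1 < n)%N /\ full_col_rank (Gblock alpha G e 0).

Section Algorithm.

(* da and db are d_alpha and d_beta. *)
Variables (alpha : 'I_2) (G : 'M[{poly {poly F}}]_(n, k)) (e da db : nat) (vhat : rword2).

Let mu := zdeg alpha G.

(* U m is the recovered coefficient of z_alpha^m in the message, if there is one;
   its value at the other indices is irrelevant. *)
Definition messages := nat -> 'cV[{poly F}]_k.

Definition block_decodable (i h w : nat) : Prop :=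
  decodable (Gblock alpha G h w) db (rblock alpha vhat i).

(* Block i minus the contributions of the message coefficients in known. *)
Definition residual (i : nat) (known : pred nat) (U : messages) : rword F n :=
  fun t c => omap (fun a => a -
      wcoef (\sum_(m < i.+1 | known m) zcoef alpha G (i - m) *m U m) t c 0)
    (rblock alpha vhat i t c).

(* Decoding block i in the code generated by [G_h, ..., G_w] and extracting the
   message coefficients i - h, ..., i - w from the result turns U into U'. *)
Definition block_decode (i h w : nat) (known : pred nat) (U U' : messages) : Prop :=
  erasure_decoder_output (Gblock alpha G h w) db (residual i known U)
    (Gblock alpha G h w *m \mxcol_(c < (h - w).+1) U' (i - h + c)%N) /\
  forall m, ~~ (i - h <= m <= i - w)%N -> U' m = U m.

(* The codeword sum_(i <= da) v_i z_alpha^i with v_i = sum_(l + m = i) G_l U_m. *)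
Definition rebuild (U : messages) : 'cV[{poly {poly F}}]_n :=
  \col_c outer alpha (\poly_(i < da.+1)
     (\sum_(m < i.+1) zcoef alpha G (i - m) *m U m) c 0).

Inductive state :=
| PhaseI of nat & messages
(* PhaseI S U: the coefficients m < S of the message are known *)
| Gap of nat & nat & nat & messages
(* Gap S T rho U: those with m < S or T <= m <= rho are known *)
| Stop of option 'cV[{poly {poly F}}]_n.
(* Stop (Some v): success with decoded word v; Stop None: failure *)

Definition phaseI_ok (S x : nat) : Prop :=
  [/\ (1 <= x <= e.+1)%N, (S + x - 1 <= da)%N & block_decodable (S + x - 1) (x - 1) 0].

Definition phaseII_ok (S y : nat) : Prop :=
  [/\ (1 <= y)%N, (S + mu + y <= da)%N & block_decodable (S + mu + y) mu 0].

(* Block T - 1 + w involves, among the unknown coefficients S, ..., T - 1, those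
   with indices T - 1 + w - h, ..., T - 1, multiplied by G_h, ..., G_w, where
   h = minn mu (T - 1 + w - S). *)
Definition gap_ok (S T w : nat) : Prop :=
  (1 <= w <= mu)%N /\ block_decodable (T - 1 + w) (minn mu (T - 1 + w - S)) w.

Inductive step : state -> state -> Prop :=
| PhaseI_decode S U x U' :
    greatest (phaseI_ok S) x ->
    block_decode (S + x - 1) (x - 1) 0 (fun m => m < S)%N U U' ->
    step (PhaseI S U) (PhaseI (S + x) U')
| PhaseI_success S U :
    (forall x, ~ phaseI_ok S x) -> (da < S)%N ->
    step (PhaseI S U) (Stop (Some (rebuild U)))
| PhaseII_decode S U y U' :
    (forall x, ~ phaseI_ok S x) -> (S <= da)%N ->
    least (phaseII_ok S) y ->
    block_decode (S + mu + y) mu 0 pred0 U U' ->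
    step (PhaseI S U) (Gap S (S + y) (S + mu + y) U')
| PhaseII_fail S U :
    (forall x, ~ phaseI_ok S x) -> (S <= da)%N ->
    (forall y, ~ phaseII_ok S y) ->
    step (PhaseI S U) (Stop None)
| Gap_closed S rho U :
    step (Gap S S rho U) (PhaseI rho.+1 U)
| Gap_decode S T rho U w U' :
    (S < T)%N ->
    least (gap_ok S T) w ->
    block_decode (T - 1 + w) (minn mu (T - 1 + w - S)) w
      (fun m => (m < S) || (T <= m))%N U U' ->
    step (Gap S T rho U) (Gap S (T - 1 + w - minn mu (T - 1 + w - S)) rho U')
| Gap_fail S T rho U :
    (S < T)%N ->
    (forall w, ~ gap_ok S T w) ->
    step (Gap S T rho U) (Stop None).

Definition initial : state := PhaseI 0 (fun _ => 0).

(* Every run from s (whatever the choices made inside erasure_decoder_output) can be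
   continued until it reaches the state t, and does reach it after finitely many
   steps. *)
Inductive leads_to (t : state) : state -> Prop :=
| leads_now : leads_to t t
| leads_later s :
    (exists s', step s s') -> (forall s', step s s' -> leads_to t s') ->
    leads_to t s.

Definition recovers (v : 'cV[{poly {poly F}}]_n) : Prop :=
  leads_to (Stop (Some v)) initial.

End Algorithm.

End TwoDimensional.

(* Main.v *)
Require Import Defs.
From HB Require Import structures.
From mathcomp Require Import all_boot all_order all_algebra.
From Stdlib Require Import Classical.

Set Implicit Arguments.
Unset Strict Implicit.
Unset Printing Implicit Defensive.

Import GRing.Theory.
Local Open Scope ring_scope.

(* Phase I alone recovers everything. If all message coefficients below S are known and
   S <= d alpha, let j r be the first index of the hypothesis with S <= j r. The code
   generated by the block row of length j r - S + 1 is contained in the one the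
   hypothesis provides for j r, its column distances are therefore at least as large, and
   block j r is an admissible choice of Phase I. Hence Phase I never gets stuck before
   S > d alpha.
   That a decoding step exists and returns the sent block rests on two facts about
   F[z]-lattices: every matrix of full column rank factors through a basis of its
   saturation, which is right prime, and a left prime H has a right inverse up to a
   scalar polynomial that is congruent to 1 modulo any power of z. Hence a sequence
   whose syndrome vanishes on a window is, on that window, the truncation of a
   codeword. *)

(** * Linear algebra over integral domains, and extremal natural numbers *)

Lemma scalemx_inj0 (R : idomainType) m p (a : R) (M : 'M[R]_(m, p)) :
  a != 0 -> a *: M = 0 -> M = 0.
Proof. by move=> a0 /eqP; rewrite scalemx_eq0 (negPf a0) => /eqP. Qed.

Lemma frac_numden (R : idomainType) (x : {fraction R}) :
  exists2 a : R, a != 0 & exists b : R, tofrac a * x = tofrac b.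
Proof.
elim/quotW: x => x; exists \d_x; first exact: denom_ratioP.
exists \n_x; have dx := denom_ratioP x.
rewrite -{2}[x]Ratio_numden; unlock FracField.tofrac.
rewrite [LHS]/GRing.mul /= -[LHS]FracField.pi_mul.
apply/eqP; rewrite FracField.equivf_def /FracField.mulf.
by rewrite !numden_Ratio ?mulr1 ?mul1r ?oner_eq0 // mulrC.
Qed.

Lemma common_denominator (R : idomainType) p (y : 'cV[{fraction R}]_p) :
  exists2 a : R, a != 0 & exists x : 'cV[R]_p, tofrac a *: y = map_mx (@tofrac R) x.
Proof.
have /fin_all_exists[a /all_and2[a0 /fin_all_exists[b ab]]] (i : 'I_p) :
    exists a : R, a != 0 /\ exists b, tofrac a * y i 0 = tofrac b.
  by have [a a0 ab] := frac_numden (y i 0); exists a.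
exists (\prod_i a i); first by apply/prodf_neq0 => i _.
exists (\col_i (\prod_(j | j != i) a j * b i)); apply/colP => i.
by rewrite !mxE (bigD1 i) //= !rmorphM /= -ab mulrCA mulrA.
Qed.

(** A common denominator turns a kernel vector over the fraction field into one over [R]. *)
Lemma full_col_rankP (R : idomainType) m p (M : 'M[R]_(m, p)) :
  full_col_rank M <-> forall x : 'cV[R]_p, M *m x = 0 -> x = 0.
Proof.
have inj0 q (z : 'cV[R]_q) : map_mx (@tofrac R) z = 0 -> z = 0.
  move/colP=> z0; apply/colP => i; have := z0 i.
  by rewrite !mxE => /eqP; rewrite tofrac_eq0 => /eqP.
rewrite /full_col_rank; split=> [rkM x Mx0 | injM].
  have /row_fullP[B BM] : row_full (map_mx (@tofrac R) M) by apply/eqP.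
  by apply: inj0; rewrite -[LHS]mul1mx -BM -mulmxA -map_mxM Mx0 map_mx0 mulmx0.
rewrite -mxrank_tr; apply/eqP; rewrite -/(row_free _) -kermx_eq0.
apply/eqP/row_matrixP => i; rewrite row0.
set y := row i _.
have [a a0 [x ax]] := common_denominator y^T.
have My : map_mx (@tofrac R) M *m y^T = 0.
  by apply/trmx_inj; rewrite trmx_mul trmxK -row_mul mulmx_ker row0 trmx0.
have /injM x0 : M *m x = 0.
  by apply: inj0; rewrite map_mxM -ax -scalemxAr My scaler0.
move: ax; rewrite x0 map_mx0 => /eqP.
rewrite scaler_eq0 tofrac_eq0 (negPf a0) /= => /eqP y0.
by apply/trmx_inj; rewrite y0 trmx0.
Qed.

Lemma full_col_rank_minor (R : idomainType) m p (M : 'M[R]_(m, p)) :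
  full_col_rank M -> exists f : 'I_p -> 'I_m, \det (rowsub f M) != 0.
Proof.
move=> rkM; have fM : row_full (map_mx (@tofrac R) M) by apply/eqP.
exists (fullrankfun fM); have := fullrowsub_unit fM.
by rewrite -map_mxsub unitmxE det_map_mx unitfE tofrac_eq0.
Qed.

Lemma minor_full_col_rank (R : idomainType) m p (M : 'M[R]_(m, p)) (f : 'I_p -> 'I_m) :
  \det (rowsub f M) != 0 -> full_col_rank M.
Proof.
move=> d0; apply/full_col_rankP => x Mx0.
have : \adj (rowsub f M) *m (rowsub f M *m x) = 0.
  by rewrite mul_rowsub_mx Mx0 rowsubE mulmx0 mulmx0.
by rewrite mulmxA mul_adj_mx mul_scalar_mx => /(scalemx_inj0 d0).
Qed.

Lemma mulmx_full_col_rank_inj (R : idomainType) m p q (M : 'M[R]_(m, p)) (A B : 'M[R]_(p, q)) :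
  full_col_rank M -> M *m A = M *m B -> A = B.
Proof.
move=> /full_col_rankP injM MAB; apply/trmx_inj/row_matrixP => i.
rewrite -!tr_col; congr (_^T); apply/eqP; rewrite -subr_eq0; apply/eqP/injM.
by rewrite mulmxBr !colE !mulmxA MAB subrr.
Qed.

Lemma nat_least (P : nat -> Prop) : (exists x, P x) -> exists x, least P x.
Proof.
case=> x; elim/ltn_ind: x => x IH Px.
have [[y [yx Py]]|no] := classic (exists y, (y < x)%N /\ P y); first exact: IH yx Py.
exists x; split=> // y Py; rewrite leqNgt; apply/negP => yx; apply: no.
by exists y.
Qed.

Lemma nat_greatest (P : nat -> Prop) b :
  (exists x, P x) -> (forall x, P x -> (x <= b)%N) -> exists x, greatest P x.
Proof.
move=> [x Px] Pb; have Pb' y : P y -> (y <= b)%N by exact: Pb.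
have [|d [[db Pd] dmin]] := @nat_least (fun d => (d <= b)%N /\ P (b - d)%N).
  by exists (b - x)%N; rewrite leq_subr subKn ?Pb'.
exists (b - d)%N; split=> // y Py; have yb := Pb' _ Py.
by have := dmin (b - y)%N; rewrite leq_subr subKn // => /(_ (conj isT Py)); rewrite leq_subCr.
Qed.

Definition set_col (R : nmodType) m p (M : 'M[R]_(m, p)) (j0 : 'I_p) (b : 'cV[R]_m) :
    'M[R]_(m, p) :=
  \matrix_(i, j) if j == j0 then b i 0 else M i j.

Lemma cramer (R : comNzRingType) p (A : 'M[R]_p) (b : 'cV[R]_p) (i : 'I_p) :
  \det (set_col A i b) = (\adj A *m b) i 0.
Proof.
rewrite (expand_det_col _ i) mxE; apply: eq_bigr => j _.
rewrite !mxE eqxx mulrC; congr (_ * _).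
rewrite /cofactor; congr (_ * \det _); apply/matrixP => r c.
by rewrite !mxE eq_sym (negPf (neq_lift _ _)).
Qed.

(** * Saturations of polynomial modules and right prime matrices *)

Section Saturation.

Variables (F : finFieldType) (n : nat).

(** Equivalently, the polynomial vectors in the column span of [M] over the field of rational
    functions. *)
Definition saturation (p : nat) (M : 'M[{poly F}]_(n, p)) (w : 'cV[{poly F}]_n) : Prop :=
  exists2 a : {poly F}, a != 0 & code1 M (a *: w).

Lemma code1D p (M : 'M[{poly F}]_(n, p)) v w :
  code1 M v -> code1 M w -> code1 M (v + w).
Proof. by move=> [x ->] [y ->]; exists (x + y); rewrite mulmxDr. Qed.

Lemma code1Z p (M : 'M[{poly F}]_(n, p)) a w : code1 M w -> code1 M (a *: w).
Proof. by move=> [x ->]; exists (a *: x); rewrite scalemxAr. Qed.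

Lemma code1_mulmx p (M : 'M[{poly F}]_(n, p)) x : code1 M (M *m x).
Proof. by exists x. Qed.

Lemma code1_sat p (M : 'M[{poly F}]_(n, p)) w : code1 M w -> saturation M w.
Proof. by exists 1; rewrite ?oner_eq0 ?scale1r. Qed.

Lemma satD p (M : 'M[{poly F}]_(n, p)) v w :
  saturation M v -> saturation M w -> saturation M (v + w).
Proof.
move=> [a a0 av] [b b0 bw]; exists (a * b); first by rewrite mulf_neq0.
rewrite scalerDr {1}[a * b]mulrC -!scalerA; exact: code1D (code1Z _ av) (code1Z _ bw).
Qed.

Lemma satZ p (M : 'M[{poly F}]_(n, p)) c w : saturation M w -> saturation M (c *: w).
Proof.
by move=> [a a0 aw]; exists a; rewrite // scalerA mulrC -scalerA; apply: code1Z.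
Qed.

Lemma satB p (M : 'M[{poly F}]_(n, p)) v w :
  saturation M v -> saturation M w -> saturation M (v - w).
Proof. by move=> sv sw; rewrite -scaleN1r; apply: satD sv (satZ _ sw). Qed.

Lemma mulmx_cols p (N : 'M[{poly F}]_(n, p)) (x : 'cV[{poly F}]_p) :
  N *m x = \sum_j x j 0 *: col j N.
Proof.
apply/colP => i; rewrite !mxE summxE; apply: eq_bigr => j _.
by rewrite !mxE mulrC.
Qed.

Lemma sat_mulmx p q (M : 'M[{poly F}]_(n, p)) (N : 'M[{poly F}]_(n, q)) x :
  (forall j, saturation M (col j N)) -> saturation M (N *m x).
Proof.
move=> satN; rewrite mulmx_cols.
elim/big_ind: _ => [||j _]; first by apply: code1_sat; exists 0; rewrite mulmx0.
- by move=> *; apply: satD.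
- exact/satZ/satN.
Qed.

Lemma code1_mx p q (M : 'M[{poly F}]_(n, p)) (N : 'M[{poly F}]_(n, q)) :
  (forall j, code1 M (col j N)) -> exists Y : 'M[{poly F}]_(p, q), N = M *m Y.
Proof.
move=> /fin_all_exists[y Ny]; exists (\matrix_(i, j) y j i 0).
apply/trmx_inj/row_matrixP => j; rewrite -!tr_col Ny; congr _^T.
rewrite [RHS]colE -mulmxA -colE; congr (_ *m _); apply/colP => i.
by rewrite !mxE.
Qed.

(** Some nonzero multiple of [w] equals [M *m x], and the nonsingular rows [f] force [x = 0]. Hence
    elements of the saturation can be compared on the rows [f] alone. *)
Lemma sat_eq0 p (M : 'M[{poly F}]_(n, p)) (f : 'I_p -> 'I_n) w :
  \det (rowsub f M) != 0 -> saturation M w -> rowsub f w = 0 -> w = 0.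
Proof.
move=> d0 [a a0 [x aw]] fw; apply: (scalemx_inj0 a0); rewrite aw.
suff -> : x = 0 by rewrite mulmx0.
apply: (scalemx_inj0 d0); rewrite -mul_scalar_mx -mul_adj_mx -mulmxA.
by rewrite mul_rowsub_mx -aw rowsubE -scalemxAr -rowsubE fw scaler0 mulmx0.
Qed.

(* Among the matrices whose columns lie in the saturation, one minimizing the degree
   of a fixed nonzero minor generates it: otherwise Euclidean division and Cramer's
   rule would produce a column whose substitution lowers that degree. *)
Lemma sat_basis p (M : 'M[{poly F}]_(n, p)) :
  full_col_rank M ->
  exists2 N : 'M[{poly F}]_(n, p), full_col_rank N &
    forall w, code1 N w <-> saturation M w.
Proof.
move=> /full_col_rank_minor[f Mf].
pose good s := exists N : 'M[{poly F}]_(n, p),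
  [/\ forall j, saturation M (col j N), \det (rowsub f N) != 0
    & size (\det (rowsub f N)) = s].
have [|s [[N [satN Nf sizeN]] smin]] := @nat_least good.
  exists (size (\det (rowsub f M))), M; split=> // j.
  by rewrite colE; apply/code1_sat/code1_mulmx.
exists N; first exact: minor_full_col_rank Nf.
move=> w; split=> [[x ->]|satw]; first exact: sat_mulmx.
set D := \det (rowsub f N) in Nf sizeN *.
have [x xE] : exists x, x = \adj (rowsub f N) *m rowsub f w by eexists.
have Dw : D *: w = N *m x.
  apply/eqP; rewrite -subr_eq0; apply/eqP.
  apply: (sat_eq0 Mf); first by apply: satB; [apply: satZ | apply: sat_mulmx].
  rewrite rowsubE mulmxBr -scalemxAr -!rowsubE -mul_rowsub_mx xE mulmxA mul_mx_adj.
  by rewrite mul_scalar_mx subrr.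
have dvdx i : D %| x i 0.
  apply: contraT => ndvd.
  pose q := x i 0 %/ D; pose w' := w - q *: col i N.
  pose N' := set_col N i w'.
  have detN' : \det (rowsub f N') = x i 0 %% D.
    have -> : rowsub f N' = set_col (rowsub f N) i (rowsub f w').
      by apply/matrixP => r c; rewrite !mxE.
    have -> : rowsub f w' = rowsub f w - q *: (rowsub f N *m delta_mx i 0).
      by rewrite mul_rowsub_mx -colE; apply/colP => r; rewrite !mxE.
    rewrite cramer mulmxBr -scalemxAr mulmxA mul_adj_mx mul_scalar_mx -xE -/D.
    by rewrite !mxE !eqxx mulr1 -/q {1}(divp_eq (x i 0) D) addrC addKr.
  have : (s <= size (\det (rowsub f N')))%N.
    apply: smin; exists N'; split=> //; last by rewrite detN'.
    move=> c; case: (eqVneq c i) => [->|ci].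
      have -> : col i N' = w' by apply/colP => r; rewrite !mxE eqxx.
      exact/satB/satZ.
    have -> : col c N' = col c N by apply/colP => r; rewrite !mxE (negPf ci).
    exact: satN.
  by rewrite detN' -sizeN leqNgt ltn_modp Nf.
exists (\col_i (x i 0 %/ D)).
apply/eqP; rewrite -subr_eq0; apply/eqP/(scalemx_inj0 Nf).
rewrite scalerBr Dw scalemxAr -mulmxBr.
suff -> : x - D *: \col_i (x i 0 %/ D) = 0 by rewrite mulmx0.
by apply/colP => i; rewrite !mxE mulrC divpK ?subrr.
Qed.

Lemma right_prime_full_col_rank p (M : 'M[{poly F}]_(n, p)) :
  right_prime M -> full_col_rank M.
Proof.
move=> prM; apply/full_col_rankP => y My; apply/eqP; apply: contraT => y0.
have [i yi] : exists i, y i 0 != 0.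
  apply/existsP; apply: contraNT y0; rewrite negb_exists => /forallP y0.
  by apply/eqP/colP => i; rewrite mxE; apply/eqP; have := y0 i; rewrite negbK.
(* M = M (1 - y c) for every row c, so 1 - y c is invertible; as it multiplies y by
   1 - c y, that scalar divides y, which c = X e_i excludes by degree. *)
pose c : 'rV[{poly F}]_p := 'X *: delta_mx 0 i.
have cy : c *m y = ('X * y i 0)%:M.
  by rewrite [c *m y]mx11_scalar -scalemxAl -rowE !mxE.
have /prM U : M = M *m (1%:M - y *m c) by rewrite mulmxBr mulmx1 mulmxA My mul0mx subr0.
have Uy : (1%:M - y *m c) *m y = (1 - 'X * y i 0) *: y.
  by rewrite mulmxBl mul1mx -mulmxA cy mul_mx_scalar scalerBl scale1r.
have : 1 - 'X * y i 0 %| y i 0.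
  have /colP/(_ i) yE : y = (1 - 'X * y i 0) *: (invmx (1%:M - y *m c) *m y).
    by rewrite scalemxAr -Uy mulKmx.
  by rewrite {2}yE mxE dvdp_mulr.
move=> /(dvdp_leq yi).
have sX : size (- ('X * y i 0)) = (size (y i 0)).+1.
  by rewrite size_polyN mulrC size_mulX.
by rewrite addrC size_polyDl sX ?ltnn // size_poly1 ltnS size_poly_gt0.
Qed.

(** If a basis [N] of the saturation factors as [B *m Y], then [\det Y *: B = N *m \adj Y] puts the
    columns of [B] in the saturation. So [B = N *m Z], and cancelling [N] gives [Z *m Y = 1]. *)
Lemma right_prime_closure p (M : 'M[{poly F}]_(n, p)) :
  full_col_rank M ->
  exists2 N, noncatastrophic_closure M N & forall w, code1 N w <-> saturation M w.
Proof.
move=> rkM; have [f Mf] := full_col_rank_minor rkM; have [N rkN NM] := sat_basis rkM.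
exists N => //; split; last first.
  have [|X MX] := @code1_mx _ _ N M.
    by move=> j; apply/NM/code1_sat; rewrite colE; apply: code1_mulmx.
  exists X; split=> //; apply: contraNneq Mf => X0.
  by rewrite MX -mul_rowsub_mx det_mulmx X0 mulr0.
move=> B Y NBY; have [g Ng] := full_col_rank_minor rkN.
have Y0 : \det Y != 0.
  by apply: contraNneq Ng => Y0; rewrite NBY -mul_rowsub_mx det_mulmx Y0 mulr0.
have [j|Z BZ] := @code1_mx _ _ N B.
  have /NM[a a0 aw] : code1 N (\det Y *: col j B).
    exists (col j (\adj Y)); rewrite !colE scalemxAl -mul_mx_scalar -mul_mx_adj.
    by rewrite !mulmxA NBY.
  by apply/NM; exists (a * \det Y); rewrite ?mulf_neq0 -?scalerA.
have /mulmx1_unit[] // : Z *m Y = 1%:M.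
by apply: (mulmx_full_col_rank_inj rkN); rewrite mulmxA -BZ -NBY mulmx1.
Qed.

(** Writing [M = N *m X] for a basis [N] of the saturation, right primeness makes [X] unimodular. *)
Lemma right_prime_saturated p (M : 'M[{poly F}]_(n, p)) w :
  right_prime M -> saturation M w -> code1 M w.
Proof.
move=> prM satw; have [N [_ [X [_ MX]]] NM] := right_prime_closure (right_prime_full_col_rank prM).
have [x ->] := (NM w).2 satw; exists (invmx X *m x).
by rewrite MX mulmxA mulmxK //; apply: prM MX.
Qed.

(** If [M(0)] kills [y], then [M] times [y] is divisible by ['X]; the quotient lies in the
    saturation, hence is [M *m x]. Cancelling [M] makes the constant vector [y] a multiple of ['X],
    so it is zero. *)
Lemma right_prime_wcoef0_inj p (M : 'M[{poly F}]_(n, p)) (y : 'cV[F]_p) :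
  right_prime M -> map_mx (coefp 0) M *m y = 0 -> y = 0.
Proof.
move=> prM My0; pose y' := map_mx polyC y.
have [w Mw] : exists w, M *m y' = 'X *: w.
  exists (\col_i ((M *m y') i 0 %/ 'X)); apply/colP => i; rewrite [RHS]mxE [in RHS]mxE mulrC.
  rewrite divpK // -['X]subr0 dvdp_XsubCl rootE horner_coef0.
  have /colP/(_ i) := My0; rewrite !mxE => My0i; rewrite -[X in _ == X]My0i coef_sum.
  by apply/eqP/eq_bigr => j _; rewrite !mxE coefMC.
have [x wx] : code1 M w.
  apply: right_prime_saturated => //; exists 'X; first by rewrite polyX_eq0.
  by rewrite -Mw; apply: code1_mulmx.
have yx : y' = 'X *: x.
  apply: (mulmx_full_col_rank_inj (right_prime_full_col_rank prM)).
  by rewrite Mw wx scalemxAr.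
apply/colP => i; have /colP/(_ i)/(congr1 (coefp 0)) := yx.
by rewrite !mxE /= coefC mulrC coefMX.
Qed.

End Saturation.

(** * Parity checks and sliding window erasure decoding *)

Section Decoder.

Variables (F : finFieldType) (n : nat).

Lemma rowsub_basis (K : fieldType) m q r (A : 'M[K]_(m, q)) :
  \rank A = r -> exists (g : 'I_r -> 'I_m) (D : 'M_(m, r)), A = D *m rowsub g A.
Proof.
move=> <-; exists (maxrankfun A).
have /submxP[D AD] : (A <= rowsub (maxrankfun A) A)%MS by rewrite eq_maxrowsub.
by exists D.
Qed.

Lemma left_prime_tr r (H : 'M[{poly F}]_(r, n)) : left_prime H -> right_prime H^T.
Proof.
move=> lpH B Y HBY; rewrite -unitmx_tr; apply: (lpH _ B^T).
by rewrite -trmx_mul -HBY trmxK.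
Qed.

Lemma right_prime_tr r (N : 'M[{poly F}]_(n, r)) : right_prime N -> left_prime N^T.
Proof.
move=> rpN Y B NYB; rewrite -unitmx_tr; apply: (rpN B^T).
by rewrite -trmx_mul -NYB trmxK.
Qed.

(* If A is the block of rows f of M and A is nonsingular, then
   \det A *: w = M *m \adj A *m rowsub f w exactly for the w in the saturation of M.
   This gives n equations of rank n - p with kernel the code; a basis of the saturation
   of their row space is left prime. *)
Lemma parity_check_exists p (M : 'M[{poly F}]_(n, p)) :
  right_prime M -> exists H, parity_check M H.
Proof.
move=> prM; have rkM := right_prime_full_col_rank prM.
have [f Mf] := full_col_rank_minor rkM.
set A := rowsub f M in Mf; pose P := M *m \adj A *m rowsub f 1%:M.
pose H1 := (\det A)%:M - P.
have PE q (w : 'M_(n, q)) : P *m w = M *m (\adj A *m rowsub f w).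
  by rewrite -!mulmxA -rowsubE.
have H1M : H1 *m M = 0.
  by rewrite mulmxBl PE -/A mul_adj_mx mul_scalar_mx mul_mx_scalar subrr.
pose fr := @tofrac {poly F}.
(* Upper bound: [H1] annihilates [M], of rank [p]. Lower bound: [H1 + P] is a scalar matrix of rank
   [n], and [P] has rank at most [p]. *)
have rkH1 : \rank (map_mx fr H1) = (n - p)%N.
  have rM : \rank (map_mx fr M) = p by exact: rkM.
  apply/eqP; rewrite eqn_leq; apply/andP; split.
    rewrite leq_subRL; last by rewrite -{1}rM rank_leq_row.
    by rewrite -{1}rM addnC; apply: mulmx0_rank_max; rewrite -map_mxM H1M map_mx0.
  rewrite leq_subLR addnC.
  have {1}<- : \rank (map_mx fr (H1 + P)) = n.
    rewrite subrK map_scalar_mx; apply: mxrank_unit.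
    by rewrite unitmxE det_scalar unitfE expf_neq0 // tofrac_eq0.
  rewrite map_mxD (leq_trans (mxrank_add _ _)) // leq_add2l.
  by rewrite /P -mulmxA map_mxM (leq_trans (mxrankM_maxl _ _)) // rank_leq_col.
have [g [B H1B]] := rowsub_basis rkH1.
pose H0 := rowsub g H1.
have H0ker (w : 'cV_n) : H0 *m w = 0 <-> code1 M w.
  split=> [H0w|[x ->]]; last by rewrite mul_rowsub_mx mulmxA H1M mul0mx rowsubE mulmx0.
  apply: right_prime_saturated => //; exists (\det A) => //; exists (\adj A *m rowsub f w).
  rewrite -PE -mul_scalar_mx; apply/eqP; rewrite -subr_eq0 -mulmxBl -/H1; apply/eqP.
  have : map_mx fr (H1 *m w) = 0.
    by rewrite map_mxM H1B -map_mxsub -mulmxA -map_mxM H0w map_mx0 mulmx0.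
  move=> /matrixP fw; apply/matrixP => i j; have := fw i j.
  by rewrite !mxE => /eqP; rewrite tofrac_eq0 => /eqP.
have rkH0 : full_col_rank H0^T.
  rewrite /full_col_rank -map_trmx mxrank_tr map_mxsub.
  apply/eqP; rewrite eqn_leq rank_leq_row /= -{1}rkH1 -/fr {1}H1B.
  exact: mxrankM_maxr.
(* Passing to the basis [N] keeps the kernel, since [H0 = Y^T *m N^T] with [\det Y] nonzero. *)
have [N [prN [Y [Y0 H0Y]]] _] := right_prime_closure rkH0.
exists N^T; split; first exact: right_prime_tr.
have H0E : H0 = Y^T *m N^T by rewrite -trmx_mul -H0Y trmxK.
move=> w; rewrite -H0ker H0E -mulmxA; split=> [->|]; first by rewrite mulmx0.
move=> YN; rewrite -det_tr in Y0; apply: (scalemx_inj0 Y0).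
by rewrite -mul_scalar_mx -mul_adj_mx -mulmxA YN mulmx0.
Qed.

(** By [right_prime_wcoef0_inj] for [H^T], the matrix [H(0)] has full row rank, so some maximal
    minor of [H] is coprime to ['X^N]. A Bezout coefficient times the adjugate of that block, padded
    with zero rows, is [B]. *)
Lemma left_prime_right_inverse r (H : 'M[{poly F}]_(r, n)) N :
  left_prime H -> exists B a, H *m B = (1 - a * 'X^N)%:M.
Proof.
move=> lpH; have prH := left_prime_tr lpH.
have fH : row_full (map_mx (coefp 0) H^T).
  rewrite /row_full -mxrank_tr -/(row_free _) -kermx_eq0.
  apply/eqP/row_matrixP => i; rewrite row0; apply: trmx_inj; rewrite trmx0.
  apply: (right_prime_wcoef0_inj prH).
  by apply: trmx_inj; rewrite trmx_mul trmxK trmx0 -row_mul mulmx_ker row0.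
pose f := fullrankfun fH; pose A := rowsub f H^T.
have co : coprimep (\det A) 'X^N.
  apply: coprimep_expr; rewrite coprimepX rootE horner_coef0 -/(coefp 0 _).
  by rewrite -det_map_mx -unitfE -unitmxE map_mxsub fullrowsub_unit.
have [[u v] /= uv] := Bezout_eq1_coprimepP _ _ co.
exists (u *: ((rowsub f 1%:M)^T *m \adj A^T)), v.
rewrite -scalemxAr mulmxA -{1}[H]trmxK -trmx_mul -rowsubE mul_mx_adj det_tr.
by rewrite scale_scalar_mx -uv addrK.
Qed.

Lemma wcoefB r (v w : 'cV[{poly F}]_r) t : wcoef (v - w) t = wcoef v t - wcoef w t.
Proof. by apply/colP => i; rewrite !mxE /= coefB. Qed.

Lemma wcoef_eq r (v w : 'cV[{poly F}]_r) : (forall t, wcoef v t = wcoef w t) -> v = w.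
Proof.
by move=> vw; apply/colP => i; apply/polyP => t; have /colP/(_ i) := vw t; rewrite !mxE.
Qed.

Lemma wcoef0 r t : wcoef (0 : 'cV[{poly F}]_r) t = 0.
Proof. by apply/colP => i; rewrite !mxE /= coef0. Qed.

Lemma wcoefXn r (w : 'cV[{poly F}]_r) m t :
  wcoef ('X^m *: w) t = if (t < m)%N then 0 else wcoef w (t - m).
Proof. by apply/colP => i; rewrite !mxE /= coefXnM; case: ifP; rewrite !mxE. Qed.

Lemma wcoef_dvdXn r (w : 'cV[{poly F}]_r) m :
  (forall t, (t < m)%N -> wcoef w t = 0) -> exists w', w = 'X^m *: w'.
Proof.
move=> w0; exists (\col_i drop_poly m (w i 0)); apply/colP => i; rewrite !mxE.
rewrite -[LHS](poly_take_drop m) mulrC [take_poly _ _](_ : _ = 0) ?add0r //.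
apply/polyP => t; rewrite coef_take_poly coef0; case: ifP => // tm.
by have /colP/(_ i) := w0 t tm; rewrite !mxE.
Qed.

Lemma wt_erasures s (r : rword F n) t (x y : 'cV[F]_n) :
  compatible s r t x -> compatible s r t y -> (wt (x - y) <= erasures s r t)%N.
Proof.
rewrite /compatible /erasures; case: ifP => _; last first.
  by move=> -> ->; rewrite subrr leqn0 cards_eq0; apply/eqP/setP => c; rewrite !inE mxE eqxx.
move=> cx cy; apply/subset_leq_card/subsetP => c; rewrite !inE !mxE.
apply: contraNT; case E: (r t c) => [a|//] _.
by rewrite (cx _ _ E) (cy _ _ E) subrr.
Qed.

(* The difference of two solutions, shifted to start at 0 and truncated after j, is
   the truncation of a codeword of weight at most the number of erasures. *)
Lemma window_solution_unique p (Mt : 'M[{poly F}]_(n, p)) H s r w0 i j w w' :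
  parity_check Mt H -> window_ok Mt s r i j ->
  code1 Mt w0 -> (forall t, compatible s r t (wcoef w0 t)) ->
  (forall t, (t < i)%N -> wcoef w t = wcoef w0 t) ->
  window_solution H s r w i j w' -> wcoef w' i = wcoef w0 i.
Proof.
move=> [lpH kerH] [d [_ dmin] lt_d] /kerH Hw0 cw0 ww0 [w'w cw' Hw'].
apply/eqP; apply: contraTT lt_d; rewrite -leqNgt => neq.
have [e we] : exists e, w' - w0 = 'X^i *: e.
  by apply: wcoef_dvdXn => t ti; rewrite wcoefB w'w // ww0 // subrr.
have et t : wcoef e t = wcoef w' (i + t) - wcoef w0 (i + t).
  by rewrite -wcoefB we wcoefXn ltnNge leq_addr addKn.
have [z Hz] : exists z, H *m e = 'X^(j.+1) *: z.
  apply: wcoef_dvdXn => t tj.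
  have -> : wcoef (H *m e) t = wcoef ('X^i *: (H *m e)) (i + t).
    by rewrite wcoefXn ltnNge leq_addr addKn.
  by rewrite scalemxAr -we mulmxBr Hw0 subr0 Hw' // leq_addr leq_add2l -ltnS.
have [B [a HB]] := left_prime_right_inverse j.+1 lpH.
(* By the choice of [B], the subtracted term has the same syndrome as the scaled [e]. Both
   modifications of [e] are multiples of ['X^(j.+1)], so its coefficients up to [j] survive. *)
pose c := (1 - a * 'X^(j.+1)) *: e - B *m (H *m e).
have /kerH cc : H *m c = 0.
  by rewrite mulmxBr (mulmxA H B) HB -scalemxAr mul_scalar_mx subrr.
have ct t : (t <= j)%N -> wcoef c t = wcoef e t.
  move=> tj; have -> : c = e - 'X^(j.+1) *: (a *: e + B *m z).
    rewrite /c Hz -scalemxAr scalerDr !scalerA scalerBl scale1r mulrC.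
    by rewrite opprD addrA.
  by rewrite wcoefB wcoefXn ltnS tj subr0.
apply: leq_trans (dmin (\sum_(t < j.+1) wt (wcoef c t)) _) _.
  exists c; split=> //; rewrite ct // et addn0 subr_eq0; exact: neq.
rewrite -{1}[i]add0n big_addn subSn ?leq_addr // addKn big_mkord.
apply: leq_sum => -[t tj] _ /=; rewrite ct // et addnC; apply: wt_erasures => //.
by apply: cw'; rewrite leq_addl addnC leq_add2l.
Qed.

(** Once the earlier coefficients agree with [w0], an admissible window determines the next one;
    beyond [s] both words vanish. *)
Lemma erasure_decoder_output_unique p (M : 'M[{poly F}]_(n, p)) s r w0 w :
  code1 M w0 -> (forall t, compatible s r t (wcoef w0 t)) ->
  erasure_decoder_output M s r w -> w = w0.
Proof.
move=> [x w0x] cw0 [Mt [H [[_ [X [_ MX]]] pcH dec wlarge]]].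
have Mtw0 : code1 Mt w0 by exists (X *m x); rewrite w0x MX mulmxA.
apply: wcoef_eq => t; elim/ltn_ind: t => t IH.
have [ts|st] := leqP t s; last by have := cw0 t; rewrite wlarge // /compatible leqNgt st.
have [j [w' [ok sol ->]]] := dec t ts.
exact: window_solution_unique pcH ok Mtw0 cw0 IH sol.
Qed.

Lemma erasure_decoder_output_sent p (M : 'M[{poly F}]_(n, p)) s r w0 :
  code1 M w0 -> (forall t, compatible s r t (wcoef w0 t)) ->
  decodable M s r -> erasure_decoder_output M s r w0.
Proof.
move=> [x w0x] cw0 [Mt clM dec]; case: (clM) => prMt [X [_ MX]].
have [H pcH] := parity_check_exists prMt; exists Mt, H; split=> //; last first.
  by move=> i si; have := cw0 i; rewrite /compatible leqNgt si.
move=> i is_; have [j ok] := dec i is_; exists j, w0; split=> //; split=> // t _.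
by rewrite (pcH.2 w0).2 ?wcoef0 //; exists (X *m x); rewrite w0x MX mulmxA.
Qed.

(** The saturation of the smaller code lies in that of the larger, so each column distance is a
    minimum over fewer words and the same windows stay admissible. *)
Lemma decodable_sub p p' (M : 'M[{poly F}]_(n, p)) (M' : 'M[{poly F}]_(n, p')) s r :
  (0 < p')%N -> full_col_rank M' -> (forall w, code1 M' w -> code1 M w) ->
  decodable M s r -> decodable M' s r.
Proof.
case: p' M' => // p' M' _ rkM' sub [Mt [prMt [X [_ MX]]] dec].
have [N clN satN] := right_prime_closure rkM'; exists N => // i is_.
have subN w : code1 N w -> code1 Mt w.
  move=> /satN[a a0 /sub[x aw]]; apply: right_prime_saturated => //.
  by exists a => //; exists (X *m x); rewrite aw MX mulmxA.
have [j [d [_ dmin] lt_d]] := dec i is_; exists j.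
(* The minimum exists: the first column of [N] has a nonzero constant coefficient, because [N(0)] is
   injective. *)
have [|d' [[w [Nw w0 d'w]] d'min]] := @nat_least (fun d => exists w,
    [/\ code1 N w, wcoef w 0 != 0 & d = \sum_(t < j.+1) wt (wcoef w t)]).
  exists (\sum_(t < j.+1) wt (wcoef (N *m delta_mx 0 0) t)), (N *m delta_mx 0 0).
  split=> //; first exact: code1_mulmx.
  rewrite -colE; apply/negP => /eqP N0.
  have /matrixP/(_ 0 0) : delta_mx 0 0 = 0 :> 'cV[F]_p'.+1.
    apply: (right_prime_wcoef0_inj clN.1).
    by rewrite -colE -[RHS]N0; apply/colP => c; rewrite !mxE.
  by rewrite !mxE !eqxx => /eqP; rewrite oner_eq0.
exists d'; first by split; [exists w | exact: d'min].
by apply: leq_trans lt_d (dmin _ _); exists w; split=> //; apply: subN.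
Qed.

Lemma decodable_dim p (M : 'M[{poly F}]_(n, p)) s r : decodable M s r -> (0 < p)%N.
Proof.
case: p M => // M [Mt _ dec]; have [j [d [[w [[x wx] w0 _]] _] _]] := dec 0%N isT.
by case/eqP: w0; rewrite wx (flatmx0 x) mulmx0 wcoef0.
Qed.

End Decoder.

(** * Coefficients and degrees with respect to one of the two variables *)

Section Outer.

Variable F : finFieldType.
Implicit Types (alpha beta : 'I_2) (p q : {poly {poly F}}).

Lemma outerM alpha : {morph @outer F alpha : p q / p * q}.
Proof. by move=> p q; rewrite /outer; case: ifP => // _; rewrite rmorphM. Qed.

Lemma outer_sum alpha k (f : 'I_k -> {poly {poly F}}) :
  outer alpha (\sum_i f i) = \sum_i outer alpha (f i).
Proof. by rewrite /outer; case: ifP => // _; rewrite raddf_sum. Qed.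

Lemma outerK alpha : involutive (@outer F alpha).
Proof. by move=> p; rewrite /outer; case: (alpha == 0); rewrite ?swapXYK. Qed.

Lemma coef_outer_swap alpha beta p a b :
  alpha != beta -> (outer alpha p)`_a`_b = (outer beta p)`_b`_a.
Proof.
rewrite /outer; case: alpha beta => [[|[|//]] ?] [[|[|//]] ?] //= _;
  by rewrite coef_swapXY.
Qed.

Lemma size_outer_leq alpha m k (M : 'M[{poly {poly F}}]_(m, k)) i j :
  (size (outer alpha (M i j)) <= (zdeg alpha M).+1)%N.
Proof.
rewrite (leq_trans (leqSpred _)) // ltnS /zdeg.
exact: (bigmax_sup i) (leq_bigmax j).
Qed.

Lemma zcoef_eq0 alpha m k (M : 'M[{poly {poly F}}]_(m, k)) l :
  (zdeg alpha M < l)%N -> zcoef alpha M l = 0.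
Proof.
move=> lt_l; apply/matrixP => i j; rewrite !mxE nth_default //.
exact: leq_trans (size_outer_leq _ _ _ _) lt_l.
Qed.

Lemma size_zcoef_leq alpha beta m k (M : 'M[{poly {poly F}}]_(m, k)) l i j :
  alpha != beta -> (size (zcoef alpha M l i j) <= (zdeg beta M).+1)%N.
Proof.
move=> ab; apply/leq_sizeP => t le_t; rewrite mxE (coef_outer_swap _ _ _ ab).
by rewrite [_`_t]nth_default ?coef0 // (leq_trans (size_outer_leq _ _ _ _)).
Qed.

Lemma zcoef_mulmx alpha n k (G : 'M[{poly {poly F}}]_(n, k)) (u : 'cV_k) i :
  zcoef alpha (G *m u) i = \sum_(m < i.+1) zcoef alpha G (i - m) *m zcoef alpha u m.
Proof.
apply/colP => c; rewrite summxE !mxE outer_sum coef_sum.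
under eq_bigr do rewrite outerM coefMr.
by rewrite exchange_big; apply: eq_bigr => m _; rewrite mxE; apply: eq_bigr => b _; rewrite !mxE.
Qed.

Lemma wcoef_zcoef_mulmx_eq0 alpha beta n k (G : 'M[{poly {poly F}}]_(n, k)) (u : 'cV_k) a b t :
  alpha != beta -> (zdeg beta G + zdeg beta u < t)%N ->
  wcoef (zcoef alpha G a *m zcoef alpha u b) t = 0.
Proof.
move=> ab lt_t; apply/colP => c; rewrite !mxE /= coef_sum big1 // => j _.
apply: nth_default; apply: leq_trans (size_polyMleq _ _) _.
apply: leq_trans _ lt_t.
have := leq_add (size_zcoef_leq G a c j ab) (size_zcoef_leq u b j 0 ab).
by rewrite addSn addnS; case: (_ + _)%N.
Qed.

End Outer.

(** * Nested codes generated by block rows of coefficients *)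

Section Blocks.

Variables (F : finFieldType) (n k : nat) (alpha : 'I_2) (G : 'M[{poly {poly F}}]_(n, k)).

Lemma Gblock_mulmx h (x : messages F k) :
  Gblock alpha G h 0 *m \mxcol_(c < (h - 0).+1) x c =
  \sum_(0 <= c < h.+1) zcoef alpha G (h - c) *m x c.
Proof. by rewrite mul_mxrow_mxcol -[X in _ = \sum_(0 <= c < X.+1) _]subn0 big_mkord. Qed.

Lemma mxcol_messages h (y : 'cV[{poly F}]_(\sum_(c < h.+1) k)) :
  exists x : messages F k, y = \mxcol_(c < h.+1) x c.
Proof.
exists (fun c => submxcol y (inord c)).
by rewrite -[LHS]submxcolK; apply: eq_mxcol => c; rewrite inord_val.
Qed.

(** [[G_h', ..., G_0]] consists of the last blocks of [[G_h, ..., G_0]], so it acts as the longer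
    row does on messages preceded by [h - h'] zeros. Both the inclusion of codes and the inheritance
    of full column rank follow. *)
Lemma Gblock_shift h h' (x : messages F k) : (h' <= h)%N ->
  \sum_(0 <= c < h'.+1) zcoef alpha G (h' - c) *m x c =
  \sum_(0 <= c < h.+1) zcoef alpha G (h - c) *m
     (if (c < h - h')%N then 0 else x (c - (h - h'))%N).
Proof.
move=> le_h; rewrite [RHS](@big_cat_nat _ _ _ (h - h')) ?leq0n //=; last by rewrite leqW ?leq_subr.
rewrite [X in _ = X + _]big_nat [X in _ = X + _]big1 ?add0r; last first.
  by move=> c /andP[_ ->]; rewrite mulmx0.
rewrite -{1}[(h - h')%N]add0n big_addn subSn ?leq_subr // subKn //.
rewrite big_nat [RHS]big_nat; apply: eq_bigr => c _.
by rewrite ltnNge leq_addl addnK addnC subnDA subKn.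
Qed.

Lemma code1_Gblock_sub h h' w : (h' <= h)%N ->
  code1 (Gblock alpha G h' 0) w -> code1 (Gblock alpha G h 0) w.
Proof.
move=> le_h [y ->]; have [x ->] := mxcol_messages y.
by rewrite Gblock_mulmx (Gblock_shift _ le_h) -Gblock_mulmx; apply: code1_mulmx.
Qed.

Lemma full_col_rank_Gblock_sub h h' : (h' <= h)%N ->
  full_col_rank (Gblock alpha G h 0) -> full_col_rank (Gblock alpha G h' 0).
Proof.
move=> le_h /full_col_rankP injG; apply/full_col_rankP => y.
have [x ->] := mxcol_messages y.
rewrite Gblock_mulmx (Gblock_shift _ le_h) -Gblock_mulmx => /injG x0.
rewrite -mxcol0; apply: eq_mxcol => -[c ltc] /=; rewrite subn0 ltnS in ltc.
have ltc' : (c + (h - h') < (h - 0).+1)%N.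
  by rewrite subn0 ltnS -[X in (_ <= X)%N](subnKC le_h) leq_add2r.
move: x0; rewrite -mxcol0 => /eq_mxcolP/(_ (Ordinal ltc')) /=.
by rewrite ltnNge leq_addl addnK.
Qed.

End Blocks.

(** Only erasure counts enter, so subtracting known contributions from a block preserves its
    decodability. *)
Lemma decodable_erasures (F : finFieldType) n p (M : 'M[{poly F}]_(n, p)) s (r r' : rword F n) :
  (forall t, erasures s r t = erasures s r' t) -> decodable M s r -> decodable M s r'.
Proof.
move=> rr' [Mt clM dec]; exists Mt => // i is_; have [j [d cd lt_d]] := dec i is_.
by exists j, d => //; under eq_bigr do rewrite -rr'.
Qed.

(** * Runs of Phase I on a received word *)

Section Run.

Variables (F : finFieldType) (n k : nat).
Variables (G : 'M[{poly {poly F}}]_(n, k)) (u : 'cV[{poly {poly F}}]_k).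
Variable d : 'I_2 -> nat.
Hypothesis Hd : forall gamma, d gamma = (zdeg gamma G + zdeg gamma u)%N.
Variable vhat : rword2 F n.
Hypothesis Hvhat : received (d 0) (d 1) (G *m u) vhat.
Variables alpha beta : 'I_2.
Hypothesis Hab : alpha != beta.
Variable e : nat.
Hypothesis rkG : full_col_rank (Gblock alpha G e 0).

Let um : messages F k := zcoef alpha u.
(** What remains of block [S + h] once the contributions of the message coefficients below [S] are
    removed. *)
Let sent (S h : nat) : 'cV[{poly F}]_n :=
  \sum_(0 <= c < h.+1) zcoef alpha G (h - c) *m um (S + c)%N.

Lemma rblock_received i t c a : (i <= d alpha)%N -> (t <= d beta)%N ->
  rblock alpha vhat i t c = Some a -> a = wcoef (zcoef alpha (G *m u) i) t c 0.
Proof.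
rewrite [wcoef _ _ _ _]mxE [zcoef _ _ _ _ _]mxE /rblock /outer.
have [[-> ->]|[-> ->]] : (alpha = 0 /\ beta = 1) \/ (alpha = 1 /\ beta = 0).
  case: alpha beta Hab => [[|[|//]] ?] [[|[|//]] ?] // _; [left|right];
    by split; apply/val_inj.
- by move=> ia tb; have [-> // | -> [<-]] := Hvhat c ia tb.
- move=> ia tb; have [-> // | -> [<-]] := Hvhat c tb ia.
  by rewrite /= coef_swapXY.
Qed.

Lemma zcoef_sent S h :
  zcoef alpha (G *m u) (S + h) =
  \sum_(m < (S + h).+1 | (m < S)%N) zcoef alpha G (S + h - m) *m um m + sent S h.
Proof.
rewrite zcoef_mulmx (bigID (fun m : 'I__ => (m < S)%N)) /=; congr (_ + _).
rewrite -(big_mkord (fun m => ~~ (m < S)%N) (fun m => zcoef alpha G (S + h - m) *m um m)).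
rewrite (@big_cat_nat _ _ _ S) //=; last by rewrite leqW // leq_addr.
rewrite big_nat_cond big1 ?add0r; last by move=> m /andP[/andP[_ ->]].
rewrite -{1}[S]add0n big_addn subSn ?leq_addr // addKn /sent.
rewrite big_mkcond; apply: eq_bigr => c _.
by rewrite ltnNge leq_addl [(S + h)%N]addnC subnDr [(c + S)%N]addnC.
Qed.

(** Up to [d beta], the same known contributions are subtracted from the received and the sent
    block; beyond it, the degrees of [G] and [u] make every coefficient zero. *)
Lemma residual_compatible S h U t : (S + h <= d alpha)%N ->
  (forall m, (m < S)%N -> U m = um m) ->
  compatible (d beta) (residual alpha G vhat (S + h) (fun m => m < S)%N U) t
    (wcoef (sent S h) t).
Proof.
move=> le_i known; rewrite /compatible; case: leqP => [le_t c b|lt_t]; last first.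
  rewrite /wcoef /sent raddf_sum /= big1 // => m _.
  by apply: (@wcoef_zcoef_mulmx_eq0 _ alpha beta); rewrite -?Hd.
rewrite /residual; case E: rblock => [a|//] [<-].
under eq_bigr => m mS do rewrite known //.
rewrite (rblock_received le_i le_t E); set K := \sum_(m < _ | _) _.
have <- : zcoef alpha (G *m u) (S + h) - K = sent S h by rewrite zcoef_sent addrC addKr.
by rewrite wcoefB [LHS]mxE [X in _ + X]mxE.
Qed.

Lemma erasures_residual i known U t :
  erasures (d beta) (residual alpha G vhat i known U) t =
  erasures (d beta) (rblock alpha vhat i) t.
Proof.
rewrite /erasures; case: ifP => // _; apply: eq_card => c; rewrite !inE /residual.
by case: rblock.
Qed.

Definition recovered (S : nat) (U : messages F k) := forall m, (m < S)%N -> U m = um m.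

Lemma block_decode_exists S x U : (0 < x)%N -> (S + x - 1 <= d alpha)%N -> recovered S U ->
  block_decodable alpha G (d beta) vhat (S + x - 1) (x - 1) 0 ->
  exists U', block_decode alpha G (d beta) vhat (S + x - 1) (x - 1) 0 (fun m => m < S)%N U U'.
Proof.
case: x => // h _; rewrite addnS !subn1 /= => le_i known dec.
(* The true message coefficients on the decoded indices, and [U] elsewhere as [block_decode]
   demands. *)
pose U' m := if (S <= m <= S + h)%N then um m else U m.
exists U'; split; last by move=> m; rewrite addnK subn0 /U' => /negPf ->.
set w := _ *m _; have -> : w = sent S h.
  rewrite /w (Gblock_mulmx _ _ _ (fun c => U' (S + h - h + c)%N)) /sent.
  rewrite big_nat [RHS]big_nat; apply: eq_bigr => c /andP[_ lec].
  by rewrite addnK /U' leq_addr leq_add2l -ltnS lec.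
apply: erasure_decoder_output_sent => [|t|].
- by rewrite /sent -(Gblock_mulmx _ _ _ (fun c => um (S + c)%N)); apply: code1_mulmx.
- exact: residual_compatible.
- by apply: decodable_erasures dec => t; rewrite erasures_residual.
Qed.

(** Uniqueness of the decoder output identifies the block; full column rank, inherited from [rkG]
    since [x <= e.+1], then identifies the message coefficients. *)
Lemma block_decode_recovered S x U U' : (0 < x <= e.+1)%N -> (S + x - 1 <= d alpha)%N ->
  recovered S U ->
  block_decode alpha G (d beta) vhat (S + x - 1) (x - 1) 0 (fun m => m < S)%N U U' ->
  recovered (S + x) U'.
Proof.
case: x => // h; rewrite addnS !subn1 /= ltnS => le_h le_i known [out keep] m lt_m.
have [mS|Sm] := ltnP m S; first by rewrite keep ?known // addnK leqNgt mS.
have outE : Gblock alpha G h 0 *m \mxcol_(c < (h - 0).+1) U' (S + h - h + c)%N =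
    Gblock alpha G h 0 *m \mxcol_(c < (h - 0).+1) um (S + c)%N.
  rewrite (Gblock_mulmx _ _ _ (fun c => um (S + c)%N)).
  apply: erasure_decoder_output_unique out => [|t]; last exact: residual_compatible.
  by rewrite /sent -(Gblock_mulmx _ _ _ (fun c => um (S + c)%N)); apply: code1_mulmx.
have /eq_mxcolP eqU := mulmx_full_col_rank_inj (full_col_rank_Gblock_sub le_h rkG) outE.
have lt_mS : (m - S < (h - 0).+1)%N by rewrite subn0 ltnS leq_subLR -ltnS.
by have := eqU (Ordinal lt_mS); rewrite /= addnK subnKC.
Qed.

Lemma rebuild_recovered U : recovered (d alpha).+1 U -> rebuild alpha G (d alpha) U = G *m u.
Proof.
move=> recU; apply/colP => c; rewrite [LHS]mxE -[RHS](outerK alpha); congr outer.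
apply/polyP => i; rewrite coef_poly.
have -> : (outer alpha ((G *m u) c 0))`_i = zcoef alpha (G *m u) i c 0 by rewrite [RHS]mxE.
rewrite zcoef_mulmx; case: ltnP => [le_i|lt_i].
  by congr (fun_of_matrix _ c 0); apply: eq_bigr => -[m lem] _; rewrite recU // (leq_trans lem).
(* Past [d alpha], every term has [m] above the degree of [u] or [i - m] above the degree of [G]. *)
rewrite big1 ?mxE // => m _; have [lt_m|le_m] := ltnP (zdeg alpha u) m.
  by rewrite (zcoef_eq0 lt_m) mulmx0.
rewrite (@zcoef_eq0 _ _ _ _ G) ?mul0mx // ltn_subRL (leq_ltn_trans _ lt_i) //.
by rewrite Hd addnC leq_add2l.
Qed.

(** Every candidate block index [S + x - 1] exceeds [d alpha], so only [PhaseI_success] applies. *)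
Lemma run_stops S U : (d alpha < S)%N -> recovered S U ->
  leads_to alpha G e (d alpha) (d beta) vhat (Stop k (Some (G *m u))) (PhaseI n S U).
Proof.
move=> lt_da recU.
have nok x : ~ phaseI_ok alpha G e (d alpha) (d beta) vhat S x.
  move=> [/andP[x0 _] le_i _]; move: lt_da; rewrite ltnNge => /negP; apply.
  by apply: leq_trans le_i; rewrite -addnBA // leq_addr.
have <- : rebuild alpha G (d alpha) U = G *m u.
  by apply: rebuild_recovered => m lem; apply/recU/(leq_trans lem).
apply: leads_later => [|s' st].
  by exists (Stop k (Some (rebuild alpha G (d alpha) U))); apply: PhaseI_success.
inversion st as [S1 U1 x1 U1' x1max | S1 U1 | S1 U1 y U1' _ le_da | S1 U1 _ le_da | | |].
- by case: (nok x1 x1max.1).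
- exact: leads_now.
- by move: le_da; rewrite leqNgt lt_da.
- by move: le_da; rewrite leqNgt lt_da.
Qed.

Lemma run_recovers :
  (forall S, (S <= d alpha)%N -> exists x, phaseI_ok alpha G e (d alpha) (d beta) vhat S x) ->
  recovers alpha G e (d alpha) (d beta) vhat (G *m u).
Proof.
move=> progress; rewrite /recovers /initial.
(* [N] bounds the number of decodings still to come, as each one advances [S] by at least 1. *)
suff run N S U : (d alpha < S + N)%N -> recovered S U ->
  leads_to alpha G e (d alpha) (d beta) vhat (Stop k (Some (G *m u))) (PhaseI n S U).
  by apply: (run (d alpha).+1).
elim: N S U => [|N IH] S U lt_da recU; have [le_da|gt_da] := leqP S (d alpha).
- by move: lt_da; rewrite addn0 ltnNge le_da.
- exact: run_stops.
- have [|x xmax] := @nat_greatest _ e.+1 (progress S le_da).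
    by move=> x [/andP[]].
  have [ex le_i dec] := xmax.1.
  apply: leads_later => [|s' st].
    have [U' dU'] := block_decode_exists (proj1 (andP ex)) le_i recU dec.
    by exists (PhaseI n (S + x) U'); apply: PhaseI_decode dU'.
  (* All other transitions out of [PhaseI] assume that no [x] is admissible, which [xmax]
     refutes. *)
  inversion st as [S1 U1 x1 U1' x1max dU1 | S1 U1 nok | S1 U1 y U1' nok | S1 U1 nok | | |];
    try by case: (nok x xmax.1).
  have [ex1 le_i1 _] := x1max.1.
  apply: IH; last exact: block_decode_recovered dU1.
  rewrite -addnA addnCA (leq_trans lt_da) // addnS -addSn -add1n.
  by rewrite addnCA addnA leq_add2r addnC leq_add2l; case/andP: ex1.
- exact: run_stops.
Qed.

End Run.

(** * Admissible Phase I blocks from the given index sequence *)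

Lemma strictly_increasing_leq (j : nat -> nat) l :
  (forall r, (r < l)%N -> (j r < j r.+1)%N) -> forall r, (r <= l)%N -> (j r <= j l)%N.
Proof.
elim: l => [|l IH] inc r; first by rewrite leqn0 => /eqP ->.
rewrite leq_eqVlt ltnS => /predU1P[-> // | rl].
by apply: leq_trans (ltnW (inc l _)) => //; apply: IH => // r' /ltnW; apply: inc.
Qed.

Theorem theorem3p2 (F : finFieldType) (n k : nat)
    (G : 'M[{poly {poly F}}]_(n, k)) (HG : full_col_rank G)
    (u : 'cV[{poly {poly F}}]_k) (v : 'cV[{poly {poly F}}]_n) (Hv : v = G *m u)
    (d : 'I_2 -> nat) (Hd : forall gamma, d gamma = (zdeg gamma G + zdeg gamma u)%N)
    (vhat : rword2 F n) (Hvhat : received (d 0) (d 1) v vhat)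
    (alpha beta : 'I_2) (Hab : alpha != beta)
    (Hkn : (k < n)%N) (HG0 : full_col_rank (zcoef alpha G 0))
    (e : nat) (He : greatest (e_candidate alpha G) e) (Hmu : zdeg alpha G = e)
    (l : nat) (j : nat -> nat)
    (Hjincr : forall r, (r < l)%N -> (j r < j r.+1)%N)
    (Hjl : j l = (zdeg alpha G + zdeg alpha u)%N)
    (Hj0 : (j 0%N <= zdeg alpha G)%N)
    (Hjgap : forall r, (r < l)%N -> (j r.+1 - (j r).+1 <= zdeg alpha G)%N)
    (Hdec0 : decodable (Gblock alpha G (j 0%N) 0) (d beta) (rblock alpha vhat (j 0%N)))
    (Hdec : forall r, (r < l)%N ->
       decodable (Gblock alpha G (j r.+1 - (j r).+1) 0) (d beta)
         (rblock alpha vhat (j r.+1))) :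
  recovers alpha G e (d alpha) (d beta) vhat v.
Proof.
have rkG := He.1.2.
(* A column distance is attained by a nonzero codeword, so the code of the first block has positive
   dimension. *)
have k0 : (0 < k)%N.
  by move: (decodable_dim Hdec0); rewrite sum_nat_const muln_gt0 => /andP[].
rewrite Hv in Hvhat *; apply: (run_recovers Hd Hvhat Hab rkG) => S le_S.
(* For the least r with S <= j r, block i = j r is decodable with h + 1 unknown message
   coefficients, of which only the last i - S + 1 are still unknown. *)
have [h [i [iS hS hmu dec]]] : exists h i, [/\ (S <= i <= d alpha)%N, (i - S <= h)%N,
    (h <= zdeg alpha G)%N & decodable (Gblock alpha G h 0) (d beta) (rblock alpha vhat i)].
  have ex : exists r, (r <= l)%N && (S <= j r)%N.
    by exists l; rewrite leqnn Hjl -Hd.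
  (* For the first index take [h = i = j 0]. Otherwise minimality gives [j r < S], hence
     [j r.+1 - S <= j r.+1 - (j r).+1]. *)
  case: (ex_minnP ex) => -[|r] /andP[rl Sr] rmin.
    by exists (j 0), (j 0); split=> //; rewrite ?leq_subr // Sr Hd -Hjl strictly_increasing_leq.
  exists (j r.+1 - (j r).+1)%N, (j r.+1); split; [|apply: leq_sub2l|exact: Hjgap|exact: Hdec].
    by rewrite Sr Hd -Hjl strictly_increasing_leq.
  by rewrite ltnNge; apply/negP => Sj; have := rmin r; rewrite ltnW // Sj ltnn => /(_ isT).
have /andP[Si ida] := iS.
(* This [x] makes the block index [S + x - 1] equal to [i], and [x <= e.+1] since
   [i - S <= h <= zdeg alpha G = e]. *)
exists (i - S).+1; rewrite /phaseI_ok /block_decodable addnS !subn1 /= subnKC //.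
split=> //; first by rewrite ltnS -Hmu (leq_trans hS).
apply: decodable_sub dec.
- by rewrite sum_nat_const card_ord muln_gt0 k0.
- by apply: full_col_rank_Gblock_sub rkG; rewrite -Hmu (leq_trans hS).
- by move=> w; apply: code1_Gblock_sub.
Qed.
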